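(* The computational complexity $\mathrm{comp}(\mathrm{id}_{\overline{\mathbf{R}_n[x]}})$ of the identification problem $\mathrm{id}_{\overline{\mathbf{R}_n[x]}}\colon \overline{\mathbf{R}_n[x]}\to\overline{\mathbf{R}_n[x]}$ for the class $|\Lambda^{\mathrm{std}}|$ is polynomial in $n$. Furthermore, this problem has a solution $(N,\phi)$, with $N$ using information operations from $|\Lambda^{\mathrm{std}}|$, such that $N$ is nonadaptive, $\mathrm{cost}_i(N,v)=2n+1$ for all $v\in\overline{\mathbf{R}_n[x]}$, and $\sup\{\mathrm{cost}_a(\phi,y)\colon y\in N(\overline{\mathbf{R}_n[x]})\}$ is polynomial in $n$.
   Context: Polynomials: for $n\in\mathbb{N}$, $\mathbf{R}_n[x]$ is the space of real polynomials $a_0+a_1x+\cdots+a_nx^n$ of degree at most $n$, regarded as functions on $\mathbf{R}$. Write $f\equiv g$ iff $f=ug$ for a scalar $u$ with $|u|=1$ (so $u=\pm1$), and $\overline{\mathbf{R}_n[x]}=\mathbf{R}_n[x]/\equiv$. The class $|\Lambda^{\mathrm{std}}|$ consists of all maps $f\mapsto|f(s)|$ with $s\in\mathbf{R}$; these are well defined on $\overline{\mathbf{R}_n[x]}$. Identification problems: let $V$ be a set, $\mathbf{K}\in\{\mathbf{R},\mathbf{C}\}$, and $\mathbf{K}^*$ the set of finite sequences of elements of $\mathbf{K}$. Let $\Lambda$ be a class of maps $V\to\mathbf{K}$ (elementary information operations). An information operator using $\Lambda$ is a map $N\colon V\to\mathbf{K}^*$ of the form $N(v)=(L_1(v),L_2(v;y_1),\ldots,L_{n(v)}(v;y_1,\ldots,y_{n(v)-1}))$,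 where $L_1\in\Lambda$, $y_1=L_1(v)$, and for $i\ge 2$ we have $L_i(\cdot;\bar y)\in\Lambda$ for all $\bar y\in\mathbf{K}^*$ and $y_i=L_i(v;y_1,\ldots,y_{i-1})$. At each step the decision whether to stop or make another evaluation depends only on the values $y_1,y_2,\ldots$ already obtained. $N$ is nonadaptive if the number and choice of operations are fixed beforehand, independently of the values obtained. A solution of $\mathrm{id}_V\colon V\to V$ is a pair $(N,\phi)$ with $N$ an information operator and $\phi\colon\mathbf{K}^*\to V$ an algorithm (possibly partial) such that $\phi\circ N=\mathrm{id}_V$. Model of computation: all objects are encoded as finite sequences of reals (a real polynomial as $(a_0,\ldots,a_n)$; an element of a quotient by a representative; a complex number by its real and imaginary parts). Algorithms are those computable by a real Blum–Shub–Smale machine augmented with $\sqrt{\cdot}$ and $\sin(\cdot)$, which are also called arithmetic operations; each arithmetic operation has unit cost. Costs: $\mathrm{cost}_i(N,v)=n(v)$; $\mathrm{cost}_a(\phi,y)$ is the number of arithmetic operations performed by $\phi$ on input $y$; $\mathrm{cost}(N,\phi)=\sup_{v\in V}(\mathrm{cost}_i(N,v)+\mathrm{cost}_a(\phi,N(v)))$; $\mathrm{comp}(\mathrm{id}_V)=\inf\{\mathrm{cost}(N,\phi)\colon (N,\phi)\text{ is a solution of }\mathrm{id}_V\}$. ''Polynomial in $n$'' means bounded above by a polynomial in $n$. *)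

(* Defs.v *)
From HB Require Import structures.
From mathcomp Require Import all_boot all_order all_algebra.
From mathcomp Require Import all_classical all_reals all_analysis.

Set Implicit Arguments.
Unset Strict Implicit.
Unset Printing Implicit Defensive.

Import Order.TTheory GRing.Theory Num.Theory.

Local Open Scope classical_set_scope.
Local Open Scope ring_scope.
Local Open Scope quotient_scope.

Section InformationOperators.
Variables (V K : Type) (Lam : set (V -> K)).

(** [io_op y] is the operation applied when the values obtained so far are [y],
    i.e. L_{size y + 1}( . ; y); [io_stop y] is the decision to stop after
    obtaining [y].  Both see only the values, not the problem element. *)
Definition answers_of (op : seq K -> V -> K) (v : V) (k : nat) : seq K :=
  iter k (fun y => rcons y (op y v)) [::].

Record info_operator := InfoOperator {
  io_op : seq K -> V -> K;
  io_stop : seq K -> bool;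
  io_op_in : forall y, Lam (io_op y);
  io_terminates : forall v,
    exists k, (0 < k)%N && io_stop (answers_of io_op v k) }.

Variable N : info_operator.

(** n(v): at least one operation is always performed, as L_1 is. *)
Definition cost_i (v : V) : nat := ex_minn (io_terminates N v).

Definition info (v : V) : seq K := answers_of (io_op N) v (cost_i v).

Definition nonadaptive : Prop :=
  exists (m : nat) (l : nat -> V -> K),
    (forall v, cost_i v = m) /\
    (forall y, (size y < m)%N -> io_op N y = l (size y)).

End InformationOperators.

(** Real Blum-Shub-Smale machines with square root and sine.
    The state space is the space of bi-infinite sequences
    (... x_{-1} x_0 . x_1 x_2 ...), and a machine is a finite list of nodes.
    Each computation node carries out a single arithmetic operation, so that a
    rational map is a sequence of nodes and operations can be counted. *)

Section BSS.
Variable R : realType.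

Definition tape := int -> R.

Inductive instr :=
| IConst of int & R                  (* x_i := c *)
| ICopy of int & int                 (* x_i := x_j *)
| IAdd of int & int & int            (* x_i := x_j + x_k *)
| ISub of int & int & int
| IMul of int & int & int
| IDiv of int & int & int
| ISqrt of int & int                 (* x_i := sqrt x_j *)
| ISin of int & int
| IShiftL
| IShiftR
| IBranch of int & nat & nat.        (* if x_i >= 0 go to the 1st, else the 2nd *)

Definition is_arith (c : instr) : bool :=
  match c with
  | IAdd _ _ _ | ISub _ _ _ | IMul _ _ _ | IDiv _ _ _ | ISqrt _ _ | ISin _ _ => true
  | _ => false
  end.

Definition config := (nat * tape)%type.

Definition upd (t : tape) (i : int) (a : R) : tape :=
  fun j => if j == i then a else t j.

(** [None] means that the machine is stuck: division by zero and square roots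
    of negative numbers are undefined. *)
Definition exec (c : instr) (s : config) : option config :=
  let: (pc, t) := s in
  match c with
  | IConst i a => Some (pc.+1, upd t i a)
  | ICopy i j => Some (pc.+1, upd t i (t j))
  | IAdd i j k => Some (pc.+1, upd t i (t j + t k))
  | ISub i j k => Some (pc.+1, upd t i (t j - t k))
  | IMul i j k => Some (pc.+1, upd t i (t j * t k))
  | IDiv i j k =>
      if t k == 0 then None else Some (pc.+1, upd t i (t j / t k))
  | ISqrt i j =>
      if t j < 0 then None else Some (pc.+1, upd t i (Num.sqrt (t j)))
  | ISin i j => Some (pc.+1, upd t i (sin (t j)))
  | IShiftL => Some (pc.+1, fun j => t (j + 1))
  | IShiftR => Some (pc.+1, fun j => t (j - 1))
  | IBranch i a b => Some (if 0 <= t i then a else b, t)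
  end.

Definition machine := seq instr.

(** The machine halts when control leaves the list of nodes. *)
Definition step (M : machine) (s : config) : option config :=
  if onth M s.1 is Some c then exec c s else Some s.

Definition halted (M : machine) (s : config) : bool := (size M <= s.1)%N.

(** Input map: (y_1, ..., y_m) becomes (... 0 1 ... 1 . y_1 ... y_m 0 ...), with
    m ones in the positions 0, -1, ..., -(m - 1). *)
Definition input_tape (y : seq R) : tape :=
  fun j => match j with
    | Posz 0 => if y is [::] then 0 else 1
    | Posz k.+1 => nth 0 y k
    | Negz k => if (k.+1 < size y)%N then 1 else 0
    end.

(** Output map: the number of consecutive ones in the positions 0, -1, ... is the
    length of the output, which is read off from position 1 onwards. *)
Definition output_of (t : tape) (z : seq R) : Prop :=
  [/\ forall k, (k < size z)%N -> t (- k%:Z) = 1,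
      t (- (size z)%:Z) <> 1 &
      forall k, (k < size z)%N -> t (k.+1)%:Z = nth 0 z k].

Definition run (M : machine) (y : seq R) (k : nat) : option config :=
  iter k (obind (step M)) (Some (0%N, input_tape y)).

Definition outputs (M : machine) (y z : seq R) : Prop :=
  exists k s, [/\ run M y k = Some s, halted M s & output_of s.2 z].

Definition performs_arith (M : machine) (s : option config) : bool :=
  if s is Some (pc, _) then
    if onth M pc is Some c then is_arith c else false
  else false.

Definition arith_count (M : machine) (y : seq R) (k : nat) : nat :=
  \sum_(j < k) performs_arith M (run M y j).

(** Number of arithmetic operations of the whole run on input [y]; the counts are
    nondecreasing in [k], and constant once the machine has halted. *)
Definition machine_cost (M : machine) (y : seq R) : \bar R :=
  ereal_sup [set ((arith_count M y k)%:R)%:E | k in [set: nat]].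

End BSS.

(** [code v z] means that the finite sequence [z] is an encoding of [v]. *)

Section Identification.
Variables (R : realType) (V : Type) (Lam : set (V -> R)).
Variable code : V -> seq R -> Prop.

(** A partial map phi : R^* -> V together with a machine computing it. *)
Record algorithm := Algorithm {
  alg_machine : machine R;
  alg_fun :> seq R -> option V;
  alg_computes : forall y v,
    alg_fun y = Some v <-> exists2 z, outputs alg_machine y z & code v z }.

Definition cost_a (phi : algorithm) (y : seq R) : \bar R :=
  machine_cost (alg_machine phi) y.

Definition solution (N : info_operator Lam) (phi : algorithm) : Prop :=
  forall v, phi (info N v) = Some v.

Definition cost (N : info_operator Lam) (phi : algorithm) : \bar R :=
  ereal_sup [set (((cost_i N v)%:R)%:E + cost_a phi (info N v))%E | v in [set: V]].

Definition complexity : \bar R :=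
  ereal_inf [set c | exists N phi, solution N phi /\ c = cost N phi].

End Identification.

Definition polynomial_in_n (R : realType) (f : nat -> \bar R) : Prop :=
  exists P : {poly R}, forall n, (f n <= (P.[n%:R])%:E)%E.

Section PolynomialsUpToSign.
Variables (R : realType) (n : nat).

Definition unit_equiv (f g : {poly_n.+1 R}) : bool :=
  `[< exists u : R, `|u| = 1 /\ f = u *: g >].

Lemma unit_equiv_refl : reflexive unit_equiv.
Proof. by move=> f; apply/asboolP; exists 1; rewrite normr1 scale1r. Qed.

Lemma unit_equiv_sub f g : unit_equiv f g -> unit_equiv g f.
Proof.
move=> /asboolP[u [u1 ->]]; apply/asboolP; exists u^-1.
have u0 : u != 0 by rewrite -normr_eq0 u1 oner_neq0.
by rewrite normfV u1 invr1 scalerA mulVf// scale1r.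
Qed.

Lemma unit_equiv_sym : symmetric unit_equiv.
Proof. by move=> f g; apply/idP/idP; exact: unit_equiv_sub. Qed.

Lemma unit_equiv_trans : transitive unit_equiv.
Proof.
move=> g f h /asboolP[u [u1 ->]] /asboolP[w [w1 ->]]; apply/asboolP.
by exists (u * w); rewrite normrM u1 w1 mulr1 scalerA.
Qed.

Canonical unit_equiv_rel :=
  EquivRel unit_equiv unit_equiv_refl unit_equiv_sym unit_equiv_trans.

Definition poly_up_to_sign := {eq_quot unit_equiv}.

Definition abs_eval (s : R) (v : poly_up_to_sign) : R :=
  `|(repr v : {poly R}).[s]|.

Lemma abs_evalE (s : R) (f : {poly_n.+1 R}) :
  abs_eval s (\pi_poly_up_to_sign f) = `|(f : {poly R}).[s]|.
Proof.
rewrite /abs_eval; case: piP => g /eqmodP /asboolP[u [u1 ->]] /=.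
by rewrite hornerZ normrM u1 mul1r.
Qed.

Definition abs_Lambda_std : set (poly_up_to_sign -> R) := range abs_eval.

(** A class is encoded by the coefficients (a_0, ..., a_n) of a representative. *)
Definition class_code (v : poly_up_to_sign) (z : seq R) : Prop :=
  exists2 f : {poly_n.+1 R},
    \pi_poly_up_to_sign f = v & z = mkseq (fun i => (f : {poly R})`_i) n.+1.

End PolynomialsUpToSign.

(* Main.v *)
Require Import Defs.
From mathcomp Require Import all_boot all_order all_algebra.
From mathcomp Require Import all_classical all_reals all_analysis.
From mathcomp Require Import zify ring.

(** The values |f(0)|, ..., |f(2n)| determine f up to sign, because their squares
    are the values of g = f^2 at 2n+1 points and deg g <= 2n: interpolation
    recovers g, and a real polynomial has at most two square roots p and -p.
    The square root is computed coefficient by coefficient.  Choose the sign so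
    that the lowest nonzero coefficient p_k of p is positive.  As long as
    p_0, ..., p_(j-1) vanish, g_(2j) = p_j^2, so p_j is the square root of
    g_(2j).  Once the pivot p_k > 0 is known, comparing coefficients of x^(k+j)
    in p^2 = g gives, for j > k,
      g_(k+j) = 2 p_k p_j + (the sum of p_i p_(k+j-i) over k < i < j),
    which is solved for p_j ([sqrt_coefE]).  Each p_j costs O(n) operations, and
    so does each coefficient of g, which is a fixed linear combination of the
    squared values ([coef_interpolation]); the total is quadratic in n.

    The machine is assembled from closure properties rather than written down.
    [computable D c F] says that F, a function of the registers 1, 2, ..., can be
    compiled at every address and for every target position beyond the registers,
    at cost at most c, when the registers satisfy D; it is closed under arithmetic, sums, square
    roots and case distinctions.  [transforms_extend] iterates the appending of
    new registers, first for the coefficients of g and then for those of p, and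
    [transforms_machine] turns the resulting program into a machine with the
    required output.  Since a machine is deterministic and a coefficient list
    determines its class, every machine defines an algorithm
    ([algorithm_of_machine]). *)

Set Implicit Arguments.
Unset Strict Implicit.
Unset Printing Implicit Defensive.

Import Order.TTheory GRing.Theory Num.Theory.

(** * Runs of a machine and their cost *)

Section Runs.
Variables (R : realType).
Implicit Types (M A B : machine R) (c : nat) (s : config R) (t : tape R).
Local Open Scope ring_scope.

Definition reaches M c s s' : Prop := exists k,
  iter k (obind (step M)) (Some s) = Some s' /\
  (\sum_(j < k) performs_arith M (iter j (obind (step M)) (Some s)) <= c)%N.

Lemma reaches_refl M c s : reaches M c s s.
Proof. by exists 0%N; rewrite big_ord0. Qed.

Lemma reaches_trans M c1 c2 s1 s2 s3 :
  reaches M c1 s1 s2 -> reaches M c2 s2 s3 -> reaches M (c1 + c2) s1 s3.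
Proof.
move=> [k1 [r1 b1]] [k2 [r2 b2]]; exists (k1 + k2)%N; split.
  by rewrite addnC iterD r1.
rewrite big_split_ord leq_add//=.
by under eq_bigr => j _ do rewrite addnC iterD r1.
Qed.

Lemma reaches_instr A B i pc t s : size A = pc -> exec i (pc, t) = Some s ->
  reaches (A ++ i :: B) (is_arith i) (pc, t) s.
Proof.
move=> sA e; have oi : onth (A ++ i :: B) pc = Some i.
  by rewrite onth_cat -sA ltnn subnn.
by exists 1%N; rewrite big_ord1 /= /step/= oi.
Qed.

Lemma reaches_leq M c c' s s' : (c <= c')%N -> reaches M c s s' -> reaches M c' s s'.
Proof. by move=> cc [k [r b]]; exists k; split=> //; exact: leq_trans b cc. Qed.

Lemma halted_iter M s k : halted M s ->
  iter k (obind (step M)) (Some s) = Some s.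
Proof. by move=> h; elim: k => //= k ->; rewrite /= /step onth_default. Qed.

Lemma run_after_halt M y k k' s : halted M s -> run M y k = Some s ->
  (k <= k')%N -> run M y k' = Some s.
Proof.
move=> h r kk; rewrite -(subnK kk) /run iterD.
by move: r; rewrite /run => ->; exact: halted_iter.
Qed.

(** A halting machine performs no operation after it has halted, so the supremum
    in the definition of the cost is attained at the halting time. *)
Lemma machine_cost_le M y c k s : halted M s -> run M y k = Some s ->
  (arith_count M y k <= c)%N -> (machine_cost M y <= (c%:R)%:E)%E.
Proof.
move=> h r b; apply: ge_ereal_sup => _ [k' _ <-].
rewrite lee_fin ler_nat; apply: leq_trans b; rewrite /arith_count.
rewrite -2!(big_mkord predT (fun j => nat_of_bool (performs_arith M (run M y j)))).
have [kk|kk] := leqP k' k; first by rewrite [X in (_ <= X)%N](big_cat_nat _ kk)//= leq_addr.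
rewrite (big_cat_nat _ (ltnW kk))//= [X in (_ + X)%N]big1_seq ?addn0// => j /=.
rewrite mem_index_iota => /andP[kj _].
by rewrite (run_after_halt h r kj); case: s h {r} => pc t h /=; rewrite onth_default.
Qed.

(** The length of the output is the position of the first entry different from 1
    to the left, so a tape has at most one output. *)
Lemma output_of_inj t z z' : output_of t z -> output_of t z' -> z = z'.
Proof.
wlog zz : z z' / (size z <= size z')%N.
  by move=> H tz tz'; have [?|/ltnW ?] := leqP (size z) (size z');
     [exact: H|symmetry; exact: H].
move=> [a1 a2 a3] [b1 b2 b3]; apply: (@eq_from_nth _ 0) => [|i iz].
  by apply/eqP; move: zz; rewrite leq_eqVlt => /orP[//|/b1].
by rewrite -a3// b3//; exact: leq_trans zz.
Qed.

Lemma outputs_inj M y z z' : outputs M y z -> outputs M y z' -> z = z'.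
Proof.
move=> [k [s [r h tz]]] [k' [s' [r' h' tz']]].
suff ss : s = s' by rewrite -ss in tz'; exact: output_of_inj tz'.
apply/Some_inj; have [kk|/ltnW kk] := leqP k k'.
  by rewrite -r' (run_after_halt h r kk).
by rewrite -r (run_after_halt h' r' kk).
Qed.

End Runs.

(** * The algorithm defined by a machine *)

Section AlgorithmOfMachine.
Variables (R : realType) (V : Type) (code : V -> seq R -> Prop).
Hypothesis code_inj : forall v v' z, code v z -> code v' z -> v = v'.
Variable M : machine R.

Let halts_on y v := exists2 z, outputs M y z & code v z.

Let machine_fun y : option V :=
  if pselect (exists v, halts_on y v) is left h then Some (projT1 (cid h)) else None.

Lemma machine_funE y v : machine_fun y = Some v <-> halts_on y v.
Proof.
rewrite /machine_fun; case: pselect => [h|nh]; last first.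
  by split=> // hv; case: nh; exists v.
case: cid => /= w hw; split=> [[<-]//|[z oz cz]]; congr Some.
by case: hw => z' /(outputs_inj oz) <- cz'; exact: code_inj cz' cz.
Qed.

Definition algorithm_of_machine : algorithm code := Algorithm machine_funE.

Lemma algorithm_of_machineE y v z : outputs M y z -> code v z ->
  algorithm_of_machine y = Some v.
Proof. by move=> Mz cz; apply/machine_funE; exists z. Qed.

End AlgorithmOfMachine.

(** * Compiling functions of the registers *)

Section Computable.
Variables (R : realType).
Implicit Types (M A B : machine R) (c d : nat) (t : tape R) (s y : seq R).
Implicit Types (D : seq R -> Prop) (F G : seq R -> R).
Local Open Scope ring_scope.

(** The sequence [s] occupies the positions 1, ..., [size s] of the tape, as an
    input does; these positions are the registers. *)
Definition holds t s := forall i, (i < size s)%N -> t i.+1 = s`_i.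

(** The target position [d.+1] is arbitrary beyond the registers and only positions
    from there on are written: the code of a compound expression can then keep
    the value of one operand at [d.+1] while it computes the next at [d.+2].  The
    code may depend on its address [off], since jumps are absolute, but not on
    the register contents [s].  The domain [D] is what makes the partial
    operations compilable: it records the sizes and signs that are known. *)
Definition computable D c F := forall d off, exists p : machine R,
  forall A B t s, size A = off -> D s -> (size s <= d)%N -> holds t s ->
  exists t', [/\ reaches (A ++ p ++ B) c (off, t) ((off + size p)%N, t'),
    t' d.+1 = F s & forall j : int, j < d.+1 -> t' j = t j].

Lemma computable_ext D c F G : (forall s, D s -> F s = G s) ->
  computable D c F -> computable D c G.
Proof.
move=> FG cF d off; have [p hp] := cF d off; exists p => A B t s sA Ds sd ts.
by have [t' [r e u]] := hp A B t s sA Ds sd ts; exists t'; rewrite -FG.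
Qed.

Lemma computable_restrict (D D' : seq R -> Prop) c F : (forall s, D s -> D' s) ->
  computable D' c F -> computable D c F.
Proof.
move=> DD cF d off; have [p hp] := cF d off; exists p => A B t s sA Ds.
exact: hp A B t s sA (DD _ Ds).
Qed.

Lemma computable_leq D c c' F : (c <= c')%N -> computable D c F -> computable D c' F.
Proof.
move=> cc cF d off; have [p hp] := cF d off; exists p => A B t s sA Ds sd ts.
have [t' [r e u]] := hp A B t s sA Ds sd ts; exists t'; split=> //.
exact: reaches_leq r.
Qed.

Lemma updE t (i : int) a : upd t i a i = a. Proof. by rewrite /upd eqxx. Qed.

Lemma upd_lt t (i j : int) a : j < i -> upd t i a j = t j.
Proof. by rewrite /upd => /lt_eqF ->. Qed.

Lemma holds_eq t t' s d : (size s <= d)%N -> (forall j : int, j < d.+1 -> t' j = t j) ->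
  holds t s -> holds t' s.
Proof.
move=> sd tt ts i si; rewrite tt ?ts// ltz_nat ltnS.
exact: leq_trans sd.
Qed.

Lemma computable_const D a : computable D 0 (fun=> a).
Proof.
move=> d off; exists [:: IConst d.+1 a] => A B t s sA _ _ _.
exists (upd t d.+1 a); split; [|by rewrite updE|by move=> j; exact: upd_lt].
by rewrite addn1; exact: (@reaches_instr _ _ _ (IConst _ _)).
Qed.

Lemma computable_nth D i : (forall s, D s -> (i < size s)%N) ->
  computable D 0 (fun s => s`_i).
Proof.
move=> Di d off; exists [:: ICopy _ d.+1 i.+1] => A B t s sA Ds _ ts.
exists (upd t d.+1 s`_i); split; [|by rewrite updE|by move=> j; exact: upd_lt].
rewrite addn1; apply: (@reaches_instr _ _ _ (ICopy _ _ _)) => //=.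
by rewrite ts// Di.
Qed.

(** All binary instructions compile in the same way: the operands go to [d.+1] and
    [d.+2], and the result replaces the first one. *)
Lemma computable_binop D c1 c2 F G (mk : int -> int -> int -> instr R)
    (f : R -> R -> R) :
  (forall s t pc i j k, D s -> t j = F s -> t k = G s ->
    exec (mk i j k) (pc, t) = Some (pc.+1, upd t i (f (F s) (G s)))) ->
  computable D c1 F -> computable D c2 G ->
  computable D (c1 + c2 + 1) (fun s => f (F s) (G s)).
Proof.
move=> mkP cF cG d off; have [p1 h1] := cF d off.
have [p2 h2] := cG d.+1 (off + size p1)%N.
exists (p1 ++ p2 ++ [:: mk d.+1 d.+1 d.+2]) => A B t s sA Ds sd ts.
have [t1 [r1 e1 u1]] := h1 A (p2 ++ [:: mk d.+1 d.+1 d.+2] ++ B) t s sA Ds sd ts.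
have [|||t2 [r2 e2 u2]] :=
  h2 (A ++ p1) ([:: mk d.+1 d.+1 d.+2] ++ B) t1 s _ Ds _ _.
- by rewrite size_cat sA.
- exact: leqW.
- exact: holds_eq u1 ts.
exists (upd t2 d.+1 (f (F s) (G s))); split; last 2 first.
- by rewrite updE.
- by move=> j jd; rewrite upd_lt// u2 ?u1//; lia.
move: r1 r2; rewrite -!catA => r1 r2.
apply: (reaches_trans (reaches_trans r1 r2)).
rewrite !size_cat /= !addnA addn1.
have -> : A ++ p1 ++ p2 ++ [:: mk d.+1 d.+1 d.+2] ++ B =
    (A ++ p1 ++ p2) ++ mk d.+1 d.+1 d.+2 :: B by rewrite -!catA.
apply: (@reaches_leq _ _ (is_arith (mk d.+1 d.+1 d.+2))); first by case: is_arith.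
apply: reaches_instr; first by rewrite !size_cat sA addnA.
by apply: mkP => //; rewrite u2// ltz_nat.
Qed.

Lemma computable_add D c1 c2 F G : computable D c1 F -> computable D c2 G ->
  computable D (c1 + c2 + 1) (fun s => F s + G s).
Proof.
apply: (@computable_binop _ _ _ _ _ (@IAdd R) +%R) => s t pc i j k _ /= -> ->.
by [].
Qed.

Lemma computable_subr D c1 c2 F G : computable D c1 F -> computable D c2 G ->
  computable D (c1 + c2 + 1) (fun s => F s - G s).
Proof.
apply: (@computable_binop _ _ _ _ _ (@ISub R) (fun a b => a - b)).
by move=> s t pc i j k _ /= -> ->.
Qed.

Lemma computable_mul D c1 c2 F G : computable D c1 F -> computable D c2 G ->
  computable D (c1 + c2 + 1) (fun s => F s * G s).
Proof.
by apply: (@computable_binop _ _ _ _ _ (@IMul R) *%R) => s t pc i j k _ /= -> ->.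
Qed.

Lemma computable_div D c1 c2 F G : (forall s, D s -> G s != 0) ->
  computable D c1 F -> computable D c2 G ->
  computable D (c1 + c2 + 1) (fun s => F s / G s).
Proof.
move=> G0; apply: (@computable_binop _ _ _ _ _ (@IDiv R) (fun a b => a / b)).
by move=> s t pc i j k Ds /= -> ->; rewrite (negPf (G0 s Ds)).
Qed.

Lemma computable_sqrt D c F : (forall s, D s -> 0 <= F s) ->
  computable D c F -> computable D (c + 1) (fun s => Num.sqrt (F s)).
Proof.
move=> F0 cF d off; have [p hp] := cF d off.
exists (p ++ [:: ISqrt _ d.+1 d.+1]) => A B t s sA Ds sd ts.
have [t1 [r1 e1 u1]] := hp A ([:: ISqrt _ d.+1 d.+1] ++ B) t s sA Ds sd ts.
exists (upd t1 d.+1 (Num.sqrt (F s))); split; last 2 first.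
- by rewrite updE.
- by move=> j jd; rewrite upd_lt// u1.
apply: (@reaches_trans _ _ _ 1%N); first by rewrite -catA; exact: r1.
rewrite size_cat /= !addnA addn1.
have -> : A ++ (p ++ [:: ISqrt _ d.+1 d.+1]) ++ B =
    (A ++ p) ++ ISqrt _ d.+1 d.+1 :: B by rewrite -!catA.
apply: (@reaches_instr _ _ _ (ISqrt _ _ _)); first by rewrite size_cat sA.
by rewrite /= e1 ltNge F0.
Qed.

(** Only the branch taken is paid for, and it is only run where its condition
    holds, so that it may divide by the tested quantity.  A branching node tests
    [0 <= x]; a strict test of H is obtained by testing the sign of -H, which costs
    the additional subtraction. *)
Lemma computable_if D c c1 c2 F G (H : seq R -> R) :
  computable D c H ->
  computable (fun s => D s /\ 0 < H s) c1 F ->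
  computable (fun s => D s /\ H s <= 0) c2 G ->
  computable D (c + 1 + maxn c1 c2) (fun s => if 0 < H s then F s else G s).
Proof.
move=> cH cF cG d off; have [p hp] := cH d off.
have [p1 h1] := cF d (off + size p + 3)%N.
have [p2 h2] := cG d (off + size p + 3 + size p1 + 1)%N.
set l1 := (off + size p + 3)%N; set l2 := (l1 + size p1 + 1)%N.
set l3 := (l2 + size p2)%N.
(* Layout: code of H, test, code of F, jump over the code of G, code of G. *)
pose q0 : machine R :=
  [:: IConst d.+2 0; ISub _ d.+1 d.+2 d.+1; IBranch _ d.+1 l2 l1].
(* The jump is unconditional because both of its targets agree. *)
pose q : machine R := [:: IBranch _ d.+1 l3 l3].
exists (p ++ q0 ++ p1 ++ q ++ p2) => A B t s sA Ds sd ts.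
have [t1 [r1 e1 u1]] := hp A (q0 ++ p1 ++ q ++ p2 ++ B) t s sA Ds sd ts.
set M := A ++ _ ++ B.
have -> : (off + size (p ++ q0 ++ p1 ++ q ++ p2) = l3)%N.
  by rewrite !size_cat /= /l3 /l2 /l1; lia.
(* Both outcomes of the test leave the same tape, with -H at [d.+1]. *)
set t2 := upd (upd t1 d.+2 0) d.+1 (- H s).
have r2 : reaches M (c + 1) (off, t) (if 0 < H s then l1 else l2, t2).
  apply: (@reaches_trans _ _ _ 1%N); first by rewrite /M -!catA; exact: r1.
  apply: (@reaches_trans _ _ 0 1%N).
    have -> : M = (A ++ p) ++ IConst d.+2 0 :: (behead q0 ++ p1 ++ q ++ p2 ++ B).
      by rewrite /M -!catA.
    by apply: (@reaches_instr _ _ _ (IConst _ _)); rewrite ?size_cat ?sA.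
  apply: (@reaches_trans _ _ 1 0%N).
    have -> : M = (A ++ p ++ take 1 q0) ++
        ISub _ d.+1 d.+2 d.+1 :: (drop 2 q0 ++ p1 ++ q ++ p2 ++ B).
      by rewrite /M -!catA.
    apply: (@reaches_instr _ _ _ (ISub _ _ _ _) _ _ ((off + size p).+2, t2)).
      by rewrite !size_cat sA /= addnA addn1.
    by rewrite /= updE (@upd_lt _ d.+2) ?ltz_nat// e1 sub0r.
  have -> : M = (A ++ p ++ take 2 q0) ++
      IBranch _ d.+1 l2 l1 :: (p1 ++ q ++ p2 ++ B) by rewrite /M -!catA.
  apply: (@reaches_instr _ _ _ (IBranch _ _ _ _)) => /=.
    by rewrite !size_cat sA /= addnA addn2.
  by rewrite [t2 _]updE oppr_ge0 leNgt; case: ltP.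
have u2 (j : int) : j < d.+1 -> t2 j = t j.
  by move=> jd; rewrite /t2 !upd_lt ?u1// (lt_trans jd)// ltz_nat.
have ts2 : holds t2 s by exact: holds_eq u2 ts.
case: ltP r2 => Hs r2.
- have [||t3 [r3 e3 u3]] := h1 (A ++ p ++ q0) (q ++ p2 ++ B) t2 s _ _ sd ts2.
  + by rewrite !size_cat sA /= addnA.
  + by split.
  exists t3; split=> // [|j jd]; last by rewrite u3// u2.
  apply: (reaches_trans r2); apply: (@reaches_leq _ _ (c1 + 0)).
    by rewrite addn0 leq_maxl.
  apply: reaches_trans.
    by rewrite -!catA in r3; rewrite /M -!catA; exact: r3.
  have -> : M = (A ++ p ++ q0 ++ p1) ++ IBranch _ d.+1 l3 l3 :: (p2 ++ B).
    by rewrite /M -!catA.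
  apply: (@reaches_instr _ _ _ (IBranch _ _ _ _)) => /=.
    by rewrite !size_cat sA /= /l1; lia.
  by case: ifP.
- have [||t3 [r3 e3 u3]] := h2 (A ++ p ++ q0 ++ p1 ++ q) B t2 s _ _ sd ts2.
  + by rewrite !size_cat sA /=; lia.
  + by split.
  exists t3; split=> // [|j jd]; last by rewrite u3// u2.
  apply: (reaches_trans r2); apply: (@reaches_leq _ _ c2).
    by rewrite leq_maxr.
  by rewrite -!catA in r3; rewrite /M -!catA; exact: r3.
Qed.

Lemma computable_sum D c (r : seq nat) (F : nat -> seq R -> R) :
  (forall i, i \in r -> computable D c (F i)) ->
  computable D (size r * c.+1) (fun s => \sum_(i <- r) F i s).
Proof.
elim: r => [|i r IH] cF.
  apply: computable_ext (computable_const D 0) => s _.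
  by rewrite big_nil.
apply: (@computable_ext _ _ (fun s => F i s + \sum_(j <- r) F j s)).
  by move=> s _; rewrite big_cons.
have -> : (size (i :: r) * c.+1 = c + size r * c.+1 + 1)%N by rewrite /=; lia.
apply: computable_add; first by apply: cF; rewrite mem_head.
by apply: IH => j jr; apply: cF; rewrite in_cons jr orbT.
Qed.

Definition extend (F : nat -> seq R -> R) m s :=
  iteri m (fun i s' => rcons s' (F i s')) s.

Lemma size_extend (F : nat -> seq R -> R) m s : size (extend F m s) = (size s + m)%N.
Proof. by elim: m => [|m IH]; rewrite ?addn0//= size_rcons IH addnS. Qed.

(** If each function returns the entry [a i] on the registers filled so far, the
    recursion produces the sequence [a]; this is how the equations satisfied by
    the coefficients of g and p yield the correctness of the program. *)
Lemma extend_mkseq (F : nat -> seq R -> R) m s (a : nat -> R) :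
  (forall i, (i < m)%N -> F i (s ++ mkseq a i) = a i) ->
  extend F m s = s ++ mkseq a m.
Proof.
elim: m => [|m IH] Fa; first by rewrite cats0.
rewrite /= IH => [|i im]; last by rewrite Fa// ltnW.
by rewrite Fa// mkseqS rcons_cat.
Qed.

(** A program on the registers may use any position to the right of 0, but has to
    leave the ones at the positions 0, -1, ... in place, because these later
    mark the length of the output. *)
Definition transforms D c (f : seq R -> seq R) := forall off, exists p : machine R,
  forall A B t s, size A = off -> D s -> holds t s ->
  exists t', [/\ reaches (A ++ p ++ B) c (off, t) ((off + size p)%N, t'),
    holds t' (f s) & forall j : int, j <= 0 -> t' j = t j].

Lemma transforms_comp (D D' : seq R -> Prop) c c' f g :
  (forall s, D s -> D' (f s)) ->
  transforms D c f -> transforms D' c' g -> transforms D (c + c') (g \o f).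
Proof.
move=> fD cf cg off; have [p hp] := cf off; have [q hq] := cg (off + size p)%N.
exists (p ++ q) => A B t s sA Ds ts.
have [t1 [r1 h1 u1]] := hp A (q ++ B) t s sA Ds ts.
have [|t2 [r2 h2 u2]] := hq (A ++ p) B t1 (f s) _ (fD _ Ds) h1.
  by rewrite size_cat sA.
exists t2; split=> // [|j j0]; last by rewrite u2// u1.
rewrite size_cat addnA; move: r1 r2; rewrite -!catA; exact: reaches_trans.
Qed.

Lemma transforms_rcons D c F : computable D c F ->
  (exists N, forall s, D s -> size s = N) ->
  transforms D c (fun s => rcons s (F s)).
Proof.
move=> cF [N DN] off; have [p hp] := cF N off.
exists p => A B t s sA Ds ts.
have [|t1 [r e u]] := hp A B t s sA Ds _ ts; first by rewrite DN.
exists t1; split=> // [i|j j0]; last by rewrite u//; lia.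
rewrite size_rcons ltnS nth_rcons DN// leq_eqVlt => /orP[/eqP->|iN].
  by rewrite ltnn eqxx e.
by rewrite iN u ?ts ?DN// ltz_nat ltnS ltnW.
Qed.

Lemma transforms_extend N c (F : nat -> seq R -> R) m :
  (forall i, (i < m)%N -> computable (fun s => size s = N + i)%N c (F i)) ->
  transforms (fun s => size s = N) (m * c) (extend F m).
Proof.
elim: m => [|m IH] cF.
  move=> off; exists [::] => A B t s sA Ds ts; exists t; split=> //.
  by rewrite addn0; exact: reaches_refl.
rewrite mulSn addnC; pose g s := rcons s (F m s).
apply: (@transforms_comp _ _ _ _ (extend F m) g) _ (IH _) (transforms_rcons (cF m _) _).
- by move=> s /= sN; rewrite size_extend sN.
- by move=> i im; apply: cF; exact: ltnW.
- by [].
- by exists (N + m)%N.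
Qed.

(** Copying in increasing order is correct even if source and target overlap: the
    source of a copy lies to the right of all positions written before it. *)
Lemma reaches_copies q m A B t :
  exists t', [/\ reaches (A ++ mkseq (fun i => ICopy R i.+1 (q + i).+1) m ++ B) 0
      (size A, t) ((size A + m)%N, t'),
    forall i, (i < m)%N -> t' i.+1 = t (q + i).+1 &
    forall j : int, ~~ (1 <= j <= m%:Z) -> t' j = t j].
Proof.
elim: m B => [|m IH] B.
  by exists t; split=> //; rewrite addn0; exact: reaches_refl.
set C := ICopy R m.+1 (q + m).+1.
have [t1 [r1 e1 u1]] := IH (C :: B).
exists (upd t1 m.+1 (t (q + m).+1)); split.
- apply: (@reaches_trans _ _ 0 0%N).
    by rewrite mkseqS cat_rcons; exact: r1.
  rewrite mkseqS cat_rcons catA addnS.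
  apply: (@reaches_instr _ _ _ (ICopy _ _ _)); first by rewrite size_cat size_mkseq.
  by rewrite /= u1//; lia.
- move=> i; rewrite ltnS leq_eqVlt => /orP[/eqP->|im]; first by rewrite updE.
  by rewrite upd_lt ?e1// ltz_nat ltnS.
- move=> j jm; rewrite /upd ifF ?u1//; lia.
Qed.

Lemma input_tape_le0 y k : (k < size y)%N -> input_tape y (- k%:Z) = 1.
Proof.
case: k => [|k] ky; first by rewrite oppr0 /=; case: y ky.
by rewrite -NegzE /= ky.
Qed.

(** The last [m] registers are copied to the front.  The input tape has ones in
    the positions 0, ..., -(N - 1), and [m <= N], so the output length [m] is
    marked by erasing the one in position [-m]. *)
Lemma transforms_machine N m q c f : (m <= N)%N ->
  (forall y, size y = N -> size (f y) = q + m)%N ->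
  transforms (fun s => size s = N) c f ->
  exists M, forall y, size y = N -> exists k (e : config R),
    [/\ run M y k = Some e, halted M e, output_of e.2 (drop q (f y)) &
        (arith_count M y k <= c)%N].
Proof.
move=> mN sf cf; have [p hp] := cf 0%N.
pose C := mkseq (fun i => ICopy R i.+1 (q + i).+1) m.
pose Z := IConst (- m%:Z) (0 : R).
exists (p ++ C ++ [:: Z]) => y yN.
have yt : holds (input_tape y) y by [].
have [t1 [r1 h1 u1]] := hp [::] (C ++ [:: Z]) _ y erefl yN yt.
have [t2 [r2 e2 u2]] := reaches_copies q m p [:: Z] t1.
pose t3 := upd t2 (- m%:Z) 0.
have r3 : reaches (p ++ C ++ [:: Z]) 0 ((size p + m)%N, t2) ((size p + m).+1, t3).
  rewrite catA; apply: (@reaches_instr _ _ _ (IConst _ _)) => //.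
  by rewrite size_cat size_mkseq.
have [k [rk bk]] := reaches_trans r1 (reaches_trans r2 r3).
exists k, ((size p + m).+1, t3); split=> //; last by rewrite !addn0 in bk.
  by rewrite /halted !size_cat size_mkseq /= addnA addn1.
have sz : size (drop q (f y)) = m by rewrite size_drop sf// addKn.
split; rewrite sz /=.
- move=> i im; rewrite /t3 /upd ifF; last by lia.
  rewrite u2; last by lia.
  by rewrite u1 ?oppr_le0// input_tape_le0// yN (leq_trans im).
- by rewrite /t3 updE; apply/eqP; rewrite eq_sym oner_eq0.
- move=> i im; rewrite /t3 /upd ifF; last by lia.
  by rewrite e2// h1 ?nth_drop// sf// ltn_add2l.
Qed.

End Computable.

(** * Square roots of polynomials and interpolation *)

Section SquareRoot.
Variable R : realType.
Implicit Types (p : {poly R}) (g h : nat -> R) (D : seq R -> Prop).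
Local Open Scope ring_scope.

(** The coefficient p_j of the square root p of g, provided that the pivot p_k is
    positive and the coefficients below it vanish. *)
Definition pivot_case g h j k (a : R) : R :=
  if 0 < h k
  then (g (k + j)%N - \sum_(k.+1 <= i < j) h i * h (k + j - i)%N) / (h k + h k)
  else a.

(** The recursion for p_j in terms of p_0, ..., p_(j-1): the first positive one among
    these is the pivot, and if there is none they all vanish. *)
Definition sqrt_coef g h j : R :=
  foldr (pivot_case g h j) (Num.sqrt (g (j + j)%N)) (iota 0 j).

Lemma eq_sqrt_coef g g' h h' j :
  (forall i, (i <= j + j)%N -> g i = g' i) ->
  (forall i, (i < j)%N -> h i = h' i) -> sqrt_coef g h j = sqrt_coef g' h' j.
Proof.
move=> gg hh; rewrite /sqrt_coef gg//.
have : all (fun k => (k < j)%N) (iota 0 j).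
  by apply/allP => k; rewrite mem_iota.
elim: (iota 0 j) => //= k r IH /andP[kj /IH ->].
rewrite /pivot_case hh// gg; last by rewrite leq_add2r ltnW.
congr (if _ then (_ - _) / _ else _).
apply: eq_big_nat => i /andP[ki ij]; rewrite !hh//; lia.
Qed.

(** The lowest nonzero coefficient is positive.  This selects one of the two
    square roots of a nonzero square, and is stated so as to include p = 0. *)
Definition lowest_coef_ge0 p := forall k, (forall i, (i < k)%N -> p`_i = 0) -> 0 <= p`_k.

Lemma unit_scale_lowest_coef_ge0 p :
  exists2 u : R, `|u| = 1 & lowest_coef_ge0 (u *: p).
Proof.
have [->|p0] := eqVneq p 0.
  by exists 1; rewrite ?normr1// => k _; rewrite scaler0 coef0.
have ex : exists k, p`_k != 0 by exists (size p).-1; rewrite -/(lead_coef p) lead_coef_eq0.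
case: (ex_minnP ex) => m pm mP.
exists (Num.sg p`_m); first by rewrite normr_sg pm.
move=> k pk; rewrite coefZ; have [km|mk|->] := ltngtP k m.
- have [->|/mP] := eqVneq p`_k 0; first by rewrite mulr0.
  by rewrite leqNgt km.
- have /eqP := pk m mk; rewrite coefZ mulf_eq0 sgr_eq0 orbb.
  by rewrite (negPf pm).
- by rewrite -normrEsg.
Qed.

Lemma coef_sqr_low p k : (forall i, (i < k)%N -> p`_i = 0) ->
  (p * p)`_(k + k) = p`_k ^+ 2.
Proof.
move=> pk; have kk : (k < (k + k).+1)%N by rewrite ltnS leq_addr.
rewrite coefM (bigD1 (Ordinal kk))//= addnK big1 ?addr0// => i /eqP ik.
have [ilt|ige] := ltnP i k; first by rewrite pk ?mul0r.
rewrite [X in _ * X]pk ?mulr0//.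
have ne : nat_of_ord i <> k by move=> e; apply: ik; exact: val_inj.
have := ltn_ord i; lia.
Qed.

(** In the convolution of order [k + j] a term survives only if both indices are
    at least [k], i.e. for k <= i <= j; the two end terms are the ones that
    contain p_j. *)
Lemma coef_sqr_above p k j : (forall i, (i < k)%N -> p`_i = 0) -> (k < j)%N ->
  (p * p)`_(k + j) =
    \sum_(k.+1 <= i < j) p`_i * p`_(k + j - i) + p`_j * (p`_k + p`_k).
Proof.
move=> pk kj; rewrite coefM.
rewrite -(big_mkord xpredT (fun i => p`_i * p`_(k + j - i))).
rewrite (@big_cat_nat _ _ _ k)//=; last by lia.
rewrite big_nat big1 ?add0r => [|i /andP[_ ik]]; last by rewrite pk ?mul0r.
rewrite (@big_cat_nat _ _ _ j.+1)//=; [|lia|lia].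
rewrite [X in _ + X]big1_seq ?addr0 => [|i]; last first.
  rewrite mem_index_iota => /andP[_ /andP[ji ikj]].
  by rewrite [X in _ * X]pk ?mulr0//; lia.
rewrite big_ltn; last by lia.
rewrite big_nat_recr//= addnK addKn; ring.
Qed.

(** Before the pivot both the coefficients and the tests of the recursion are
    trivial, and the first nonzero coefficient is positive by the choice of sign,
    so the recursion stops its search exactly at the pivot. *)
Lemma sqrt_coefE p j : lowest_coef_ge0 p ->
  sqrt_coef (fun i => (p * p)`_i) (fun i => p`_i) j = p`_j.
Proof.
move=> p_ge0; rewrite /sqrt_coef.
(* The search passes over vanishing coefficients. *)
have skip k m z (f : nat -> R) : (forall i, (k <= i < k + m)%N -> p`_i = 0) ->
    foldr (pivot_case f (fun i => p`_i) j) z (iota k m) = z.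
  elim: m k => //= m IH k pk.
  rewrite /pivot_case pk ?leqnn ?ltnn ?leq_addr//; last by lia.
  by rewrite ltxx -/pivot_case IH// => i ik; rewrite pk//; lia.
have [ex|nex] := pselect (exists k, (k < j)%N && (p`_k != 0)); last first.
  have p0 i : (i < j)%N -> p`_i = 0.
    move=> ij; apply/eqP; apply: contrapT => /negP pi; apply: nex.
    by exists i; rewrite ij.
  rewrite skip => [|i]; last by rewrite add0n; exact: p0.
  by rewrite coef_sqr_low// sqrtr_sqr ger0_norm// p_ge0.
case: (ex_minnP ex) => k /andP[kj pk] kmin.
have p0 i : (i < k)%N -> p`_i = 0.
  move=> ik; apply/eqP; apply: contraTT ik => pi; rewrite -leqNgt.
  by have [ij|ji] := ltnP i j; [apply: kmin; rewrite ij|lia].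
have pk0 : 0 < p`_k by rewrite lt_def pk p_ge0.
have -> : iota 0 j = iota 0 k ++ k :: iota k.+1 (j - k.+1).
  by rewrite -[k :: _]/(iota k (j - k.+1).+1) -{2}[k]add0n -iotaD; congr iota; lia.
rewrite foldr_cat skip => [|i]; last by rewrite add0n; exact: p0.
rewrite /= /pivot_case pk0 coef_sqr_above// [X in X / _]addrC addKr mulfK//.
by rewrite gt_eqF// addr_gt0.
Qed.

(** The machine is stuck on square roots of negative numbers, whereas [Num.sqrt]
    vanishes there; a case distinction restores totality. *)
Lemma computable_total_sqrt D c (F : seq R -> R) : computable D c F ->
  computable D (c + c + 2) (fun s => Num.sqrt (F s)).
Proof.
move=> cF; apply: (@computable_ext _ _ _
  (fun s => if 0 < F s then Num.sqrt (F s) else 0)).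
  by move=> s _; case: ltP => // F0; rewrite ler0_sqrtr.
have -> : (c + c + 2 = c + 1 + maxn (c + 1) 0)%N by lia.
apply: computable_if => //; last exact: computable_const.
apply: computable_sqrt => [s [_ /ltW]//|].
by apply: computable_restrict cF => s [].
Qed.

(** The coefficients of g are read from the registers after [a], those of p from
    the registers after [b].  Searching the pivot costs one operation per
    candidate, and then a single formula of linear size is evaluated. *)
Lemma computable_sqrt_coef D a b j :
  (forall s, D s -> (a + (j + j) < size s)%N) ->
  (forall s, D s -> (b + j <= size s)%N) ->
  computable D (j + (2 * j + 2))
    (fun s => sqrt_coef (fun i => s`_(a + i)) (fun i => s`_(b + i)) j).
Proof.
move=> Da Db; rewrite /sqrt_coef.
pose f (s : seq R) := pivot_case (fun i => s`_(a + i)) (fun i => s`_(b + i)) j.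
suff chain (r : seq nat) : all (fun k => (k < j)%N) r ->
    computable D (size r + (2 * j + 2))
      (fun s => foldr (f s) (Num.sqrt s`_(a + (j + j))) r).
  rewrite -[X in (X + (2 * j + 2))%N](size_iota 0 j); apply: chain.
  by apply/allP => k; rewrite mem_iota.
elim: r => [_|k r IH /= /andP[kj /IH {}IH]] /=.
  apply: (@computable_leq _ _ (0 + 0 + 2)); first by lia.
  by apply/computable_total_sqrt/computable_nth.
have cb (D' : seq R -> Prop) i : (forall s, D' s -> D s) -> (i < j)%N ->
    computable D' 0 (fun s => s`_(b + i)).
  by move=> DD ij; apply: computable_nth => s /DD /Db; lia.
apply: (@computable_leq _ _ (0 + 1 + maxn (2 * j + 2) (size r + (2 * j + 2)))).
  by lia.
apply: computable_if; [exact: cb| |by apply: computable_restrict IH => s []].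
have DD s : D s /\ 0 < s`_(b + k) -> D s by case.
apply: (@computable_leq _ _ (0 + (j - k.+1) * 2 + 1 + (0 + 0 + 1) + 1)); first by lia.
apply: computable_div.
- by move=> s [_ s0]; rewrite gt_eqF// addr_gt0.
- apply: computable_subr.
    by apply: computable_nth => s [/Da + _]; lia.
  rewrite -(size_iota k.+1 (j - k.+1)).
  apply: computable_sum => i; rewrite mem_iota => ki.
  by apply: (@computable_mul _ _ 0 0); apply: cb => //; lia.
- by apply: (@computable_add _ _ 0 0); apply: cb.
Qed.

(** The weights [(L i)`_j] depend on neither p nor its values, so a machine may
    contain them as constants. *)
Lemma coef_interpolation N : exists L : nat -> {poly R}, forall p j,
  (size p <= N.+1)%N ->
  p`_j = \sum_(0 <= i < N.+1) (L i)`_j * p.[i%:R].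
Proof.
pose x (i : nat) : R := i%:R.
have xi : injective x by move=> i j /eqP; rewrite eqr_nat => /eqP.
exists (fun i => ((lagrange N.+1 x)`_i : {poly_N.+1 R})) => p j sp.
rewrite {1}(lagrange_gen (isT : (0 < N.+1)%N) xi sp) coef_sum big_mkord.
by apply: eq_bigr => i _; rewrite coefCM mulrC nth_lagrange.
Qed.

End SquareRoot.

(** * Sampling at 0, ..., 2n and recovering the class *)

Section Solution.
Variable (R : realType) (n : nat).
Local Open Scope ring_scope.
Local Open Scope quotient_scope.

Definition sample_op (y : seq R) : poly_up_to_sign R n -> R := @abs_eval R n (size y)%:R.

Definition sample_stop (y : seq R) : bool := size y == (2 * n + 1)%N.

Lemma size_answers (V K : Type) (op : seq K -> V -> K) v k :
  size (answers_of op v k) = k.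
Proof. by elim: k => //= k IH; rewrite size_rcons IH. Qed.

Lemma sample_op_in y : abs_Lambda_std (sample_op y).
Proof. by exists (size y)%:R. Qed.

Lemma sample_terminates v :
  exists k, (0 < k)%N && sample_stop (answers_of sample_op v k).
Proof.
by exists (2 * n + 1)%N; rewrite /sample_stop size_answers eqxx addn1.
Qed.

Definition sample_operator : info_operator (@abs_Lambda_std R n) :=
  InfoOperator sample_op_in sample_terminates.

Lemma cost_i_sample v : cost_i sample_operator v = (2 * n + 1)%N.
Proof.
rewrite /cost_i; case: ex_minnP => m /andP[_].
by rewrite /= /sample_stop size_answers => /eqP.
Qed.

Lemma nonadaptive_sample : nonadaptive sample_operator.
Proof.
exists (2 * n + 1)%N, (fun i => @abs_eval R n i%:R).
by split=> // v; exact: cost_i_sample.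
Qed.

Lemma info_sample v :
  info sample_operator v = mkseq (fun i => abs_eval i%:R v) (2 * n + 1).
Proof.
rewrite /info cost_i_sample.
elim: (2 * n + 1)%N => //= m IH; rewrite -/(answers_of _ _ _) IH mkseqS.
by rewrite /= /sample_op size_mkseq.
Qed.

Lemma class_code_inj (v v' : poly_up_to_sign R n) z :
  class_code v z -> class_code v' z -> v = v'.
Proof.
move=> [f <- ->] [f' <- ff]; congr (\pi_ _ _); apply: val_inj; apply/polyP => i /=.
have [ni|ni] := leqP n.+1 i.
  by rewrite !nth_default// (leq_trans (size_npoly _)).
by have := congr1 (nth 0 ^~ i) ff; rewrite /= !nth_mkseq.
Qed.

(** The first summand is the interpolation, 2n+1 coefficients with three operations
    per sample; the second one is the recursion for the n+1 coefficients of the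
    square root. *)
Definition solution_cost := ((2 * n + 1) * ((2 * n + 1) * 3) + n.+1 * (3 * n + 2))%N.

(** The registers hold the 2n+1 values, then the 2n+1 coefficients of the square,
    then the n+1 coefficients of the root; the latter represent the class. *)
Lemma solving_machine : exists M : machine R, forall v, exists k e z,
  [/\ run M (info sample_operator v) k = Some e, halted M e, output_of e.2 z,
    class_code v z & (arith_count M (info sample_operator v) k <= solution_cost)%N].
Proof.
pose N := (2 * n + 1)%N; have NE : N = (2 * n).+1 by rewrite /N addn1.
have [L LP] := coef_interpolation R (2 * n).
pose G j (s : seq R) := \sum_(0 <= i < N) (L i)`_j * (s`_i * s`_i).
pose H j (s : seq R) := sqrt_coef (fun i => s`_(N + i)) (fun i => s`_(N + N + i)) j.
pose f := extend H n.+1 \o extend G N.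
have tf : transforms (fun s => size s = N) solution_cost f.
  apply: (@transforms_comp _ _ (fun s => size s = N + N)%N).
  - by move=> s sN; rewrite size_extend sN.
  - apply: transforms_extend => i iN.
    rewrite [X in (X * _)%N](_ : _ = size (index_iota 0 N)); last by rewrite size_iota subn0.
    apply: computable_sum => k; rewrite mem_index_iota => /andP[_ kN].
    apply: (computable_mul (c1 := 0) (c2 := 0 + 0 + 1)); first exact: computable_const.
    by apply: (@computable_mul _ _ 0 0); apply: computable_nth => s ->; lia.
  - apply: transforms_extend => i iN.
    apply: (@computable_leq _ _ (i + (2 * i + 2))); first by lia.
    by apply: computable_sqrt_coef => s ->; lia.
have [|y yN|M MP] := transforms_machine (m := n.+1) (q := N + N) _ _ tf.
- by rewrite NE; lia.
- by rewrite -[f y]/(extend H n.+1 (extend G N y)) !size_extend yN.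
exists M => v; set y := info _ v.
have yN : size y = N by rewrite /y info_sample size_mkseq.
have [k [e [re he oe ce]]] := MP y yN.
exists k, e, (drop (N + N) (f y)); split=> //.
have [u u1 pge0] := unit_scale_lowest_coef_ge0 (repr v : {poly R}).
pose p : {poly R} := u *: (repr v : {poly R}); rewrite -/p in pge0.
have sp : (size p <= n.+1)%N.
  by apply: leq_trans (size_scale_leq _ _) _; exact: size_npoly.
have yi i : (i < N)%N -> y`_i = `|p.[i%:R]|.
  move=> iN; rewrite /y info_sample nth_mkseq// /abs_eval hornerZ normrM u1 mul1r.
  by [].
have spp : (size (p * p)%R <= (2 * n).+1)%N.
  by apply: leq_trans (size_polyMleq _ _) _; lia.
have GE : extend G N y = y ++ mkseq (fun j => (p * p)`_j) N.
  apply: extend_mkseq => j jN; rewrite /G (LP _ _ spp) -NE.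
  apply: eq_big_nat => i /andP[_ iN]; congr (_ * _).
  by rewrite nth_cat yN iN yi// hornerM -normrM ger0_norm// -expr2 sqr_ge0.
have HE : f y = (y ++ mkseq (fun j => (p * p)`_j) N) ++ mkseq (fun j => p`_j) n.+1.
  rewrite -[f y]/(extend H n.+1 (extend G N y)) GE; apply: extend_mkseq => j jn; rewrite /H -[RHS]sqrt_coefE//.
  apply: eq_sqrt_coef => i ij.
    rewrite nth_cat size_cat size_mkseq yN ifT; last by lia.
    by rewrite nth_cat yN ifF ?addKn ?nth_mkseq//; lia.
  rewrite nth_cat size_cat size_mkseq yN ifF; last by lia.
  by rewrite addKn nth_mkseq.
have -> : drop (N + N) (f y) = mkseq (fun j => p`_j) n.+1.
  by rewrite HE drop_size_cat// size_cat size_mkseq yN.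
exists (u *: (repr v : {poly_n.+1 R})) => //.
rewrite -[RHS]reprK; apply/eqmodP/asboolP; exists u; split=> //.
Qed.

End Solution.

(** * The complexity bound *)

Section Main.
Variable R : realType.
Local Open Scope ring_scope.

Definition solving_algorithm n : algorithm (@class_code R n) :=
  algorithm_of_machine (@class_code_inj R n) (projT1 (cid (solving_machine R n))).

Lemma solving_algorithmP n :
  solution (sample_operator R n) (solving_algorithm n) /\
  (forall v, (cost_a (solving_algorithm n) (info (sample_operator R n) v)
    <= ((solution_cost n)%:R)%:E)%E).
Proof.
have MP := projT2 (cid (solving_machine R n)).
split=> v; have [k [e [z [re he oe ce be]]]] := MP v.
  by apply: (@algorithm_of_machineE _ _ _ _ _ _ _ z) => //; exists k, e.
exact: machine_cost_le he re be.
Qed.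

Lemma polynomial_in_n_nat (P : {poly R}) (f : nat -> \bar R) (c : nat -> nat) :
  (forall n, (f n <= ((c n)%:R)%:E)%E) -> (forall n, (c n)%:R = P.[n%:R]) ->
  polynomial_in_n f.
Proof. by move=> fc cP; exists P => n; rewrite -cP. Qed.

End Main.

Theorem theorem3p1 (R : realType) :
  polynomial_in_n (fun n => complexity (@abs_Lambda_std R n) (@class_code R n)) /\
  exists (N : forall n : nat, info_operator (@abs_Lambda_std R n))
         (phi : forall n : nat, algorithm (@class_code R n)),
    (forall n : nat,
       solution (N n) (phi n) /\
       nonadaptive (N n) /\
       (forall v : poly_up_to_sign R n, cost_i (N n) v = (2 * n + 1)%N)) /\
    polynomial_in_n (fun n =>
      ereal_sup (image (range (info (N n))) (cost_a (phi n)))).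
Proof.
split.
  apply: (@polynomial_in_n_nat _
    ((2 *: 'X + 1) + ((2 *: 'X + 1) * ((2 *: 'X + 1) * 3%:P) + ('X + 1) * (3 *: 'X + 2%:P)))%R
    _ (fun n => (2 * n + 1) + solution_cost n)%N) => n; last first.
    by rewrite /solution_cost -(addn1 n) !(natrD, natrM) !hornerE; ring.
  have [sol costP] := solving_algorithmP R n.
  apply: le_trans (_ : cost (sample_operator R n) (solving_algorithm R n) <= _)%E.
    by apply: ereal_inf_lbound; exists (sample_operator R n), (solving_algorithm R n).
  apply: ge_ereal_sup => _ [v _ <-]; rewrite natrD EFinD cost_i_sample.
  by rewrite leeD2l.
exists (sample_operator R), (solving_algorithm R); split=> [n|].
  have [sol _] := solving_algorithmP R n; split=> //.
  by split; [exact: nonadaptive_sample|exact: cost_i_sample].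
apply: (@polynomial_in_n_nat _
    ((2 *: 'X + 1) * ((2 *: 'X + 1) * 3%:P) + ('X + 1) * (3 *: 'X + 2%:P))%R
    _ (fun n => solution_cost n)) => n; last first.
  by rewrite /solution_cost -(addn1 n) !(natrD, natrM) !hornerE; ring.
have [_ costP] := solving_algorithmP R n.
by apply: ge_ereal_sup => _ [_ [v _ <-] <-].
Qed.
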